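(* Consider the multiplayer reach-avoid game with attackers $P_{A_1},\dots,P_{A_{N_A}}$ and defenders $P_{B_1},\dots,P_{B_{N_D}}$ from given initial positions. Let $G$ be the bipartite graph whose two node classes are the set of attackers and the set of defenders, with an edge between $P_{B_i}$ and $P_{A_j}$ if and only if $P_{B_i}$ wins against $P_{A_j}$ in the two-player reach-avoid game (started from the initial positions of these two players). If a maximum matching of $G$ has size $m$, then the defending team is able to prevent at least $m$ attackers from reaching the target set $\mathcal{T}$ without being captured, regardless of the attackers' actions; consequently $N_A-m$ is an upper bound on the number of attackers that can reach the target set.
   Context: Domain: $\Omega\subset\mathbb{R}^2$ is a bounded open domain, partitioned as $\Omega=\Omega_{\rm free}\cup\Omega_{\rm obs}$ with $\Omega_{\rm free}$ compact (free space) and $\Omega_{\rm obs}=\Omega\setminus\Omega_{\rm free}$ (obstacles). The target set $\mathcal{T}\subset\Omega_{\rm free}$ is compact. Dynamics: with positions $x_{A_i},x_{B_j}\in\mathbb{R}^2$, initial positions $x_{A_i}^0,x_{B_j}^0\in\Omega_{\rm free}$ and maximum speeds $v_{A_i},v_{B_j}$, the players move for $t\ge 0$ according to $\dot x_{A_i}(t)=v_{A_i}a_i(t)$, $x_{A_i}(0)=x_{A_i}^0$ $(i=1,\dots,N_A)$ and $\dot x_{B_j}(t)=v_{B_j}b_j(t)$, $x_{B_j}(0)=x_{B_j}^0$ $(j=1,\dots,N_D)$, where the controls $a_i,b_j$ are measurable functions from $[0,\infty)$ to the closed unit disk of $\mathbb{R}^2$. All players must remain in $\Omega_{\rm free}$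 for all time. Capture: $P_{A_i}$ is captured by $P_{B_j}$ if $\|x_{A_i}-x_{B_j}\|_2\le R_C$, where $R_C$ is the capture radius. Two-player reach-avoid game between one attacker $P_A$ and one defender $P_B$ (same dynamics, domain, target and capture rule): $P_A$ wins if it reaches $\mathcal{T}$ without being captured by $P_B$. $P_B$ wins if, regardless of the attacker's actions, it can prevent $P_A$ from winning, by capturing $P_A$ or indefinitely delaying $P_A$ from reaching $\mathcal{T}$. The defender's winning control may respond to the motion of the attacker (closed-loop control) and, in the two-player game, involves only the states of these two players. Multiplayer game: all players move simultaneously; an attacker is prevented from reaching the target if it is captured by some defender before reaching $\mathcal{T}$ or is indefinitely delayed from reaching $\mathcal{T}$. The number of attackers ''that can reach the target'' counts those reaching $\mathcal{T}$ without having been captured, when the defending team uses a suitable joint control. A matching is a set of pairwise disjoint edges; a maximum matching is one of largest cardinality. *)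

(* Defs.v *)
From HB Require Import structures.
From mathcomp Require Import all_boot all_order all_algebra.
From mathcomp Require Import all_classical all_reals all_analysis.
Set Implicit Arguments.
Unset Strict Implicit.
Unset Printing Implicit Defensive.
Import Order.TTheory GRing.Theory Num.Theory.
Import numFieldNormedType.Exports.
Local Open Scope classical_set_scope.
Local Open Scope ring_scope.

(* The library norm on 'rV[R]_2 is the sup norm (it induces the usual topology
   and bounded sets), so the Euclidean norm is defined separately. *)
Definition norm2 (R : realType) (x : 'rV[R]_2) : R :=
  Num.sqrt (\sum_(k < 2) x 0 k ^+ 2).

Record player (R : realType) := Player {
  start : 'rV[R]_2 ;
  max_speed : R }.

(* Controls are total functions of time, but only their values at times t >= 0
   are ever used. *)
Definition control (R : realType) (u : R -> 'rV[R]_2) : Prop :=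
  (forall k : 'I_2, measurable_fun (`[0, +oo[ : set R) (fun t : R => u t 0 k)) /\
  (forall t : R, 0 <= t -> norm2 (u t) <= 1).

(* The (Caratheodory) solution of x' = v u(t), x(0) = x0. *)
Definition motion (R : realType) (p : player R) (u : R -> 'rV[R]_2) (t : R) :
    'rV[R]_2 :=
  \row_(k < 2) (start p 0 k +
    max_speed p * (\int[lebesgue_measure]_(s in `[0, t]) u s 0 k)%R).

Definition admissible (R : realType) (free : set 'rV[R]_2) (p : player R)
    (u : R -> 'rV[R]_2) : Prop :=
  control u /\ forall t : R, 0 <= t -> free (motion p u t).

(* A closed-loop (nonanticipative) strategy of a team of defenders B against
   attackers A: it turns the motions of the attackers into admissible controls
   of the defenders, and the controls up to time t depend only on the motions
   up to time t. *)
Definition closed_loop_strategy (R : realType) (free : set 'rV[R]_2)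
    (I J : Type) (A : I -> player R) (B : J -> player R)
    (S : (I -> R -> 'rV[R]_2) -> J -> R -> 'rV[R]_2) : Prop :=
  (forall a : I -> R -> 'rV[R]_2,
     (forall i, admissible free (A i) (a i)) ->
     forall j, admissible free (B j) (S (fun i => motion (A i) (a i)) j)) /\
  (forall (a a' : I -> R -> 'rV[R]_2) (t : R),
     (forall i, admissible free (A i) (a i)) ->
     (forall i, admissible free (A i) (a' i)) ->
     (forall i (s : R), 0 <= s <= t -> motion (A i) (a i) s = motion (A i) (a' i) s) ->
     forall j, {ae lebesgue_measure, forall s : R, 0 <= s <= t ->
       S (fun i => motion (A i) (a i)) j s =
       S (fun i => motion (A i) (a' i)) j s}).

Definition capture_times (R : realType) (rC : R) (J : Type)
    (xA : R -> 'rV[R]_2) (xB : J -> R -> 'rV[R]_2) : set R :=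
  [set t : R | 0 <= t /\ exists j, norm2 (xA t - xB j t) <= rC].

(* An attacker captured at the very moment it enters the target counts as
   captured. *)
Definition reaches_uncaptured (R : realType) (target : set 'rV[R]_2) (rC : R)
    (J : Type) (xA : R -> 'rV[R]_2) (xB : J -> R -> 'rV[R]_2) : Prop :=
  exists t : R, [/\ 0 <= t, target (xA t) &
    forall s : R, 0 <= s <= t -> ~ capture_times rC xA xB s].

Definition prevented (R : realType) (target : set 'rV[R]_2) (rC : R)
    (J : Type) (xA : R -> 'rV[R]_2) (xB : J -> R -> 'rV[R]_2) : Prop :=
  (exists2 s, capture_times rC xA xB s &
    forall t : R, 0 <= t < s -> ~ target (xA t)) \/
  (forall t : R, 0 <= t -> ~ target (xA t)).

(* The two-player game is the game in which both teams are indexed by unit. *)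
Definition defender_wins (R : realType) (free target : set 'rV[R]_2) (rC : R)
    (pB pA : player R) : Prop :=
  exists S : (unit -> R -> 'rV[R]_2) -> unit -> R -> 'rV[R]_2,
    closed_loop_strategy free (fun=> pA) (fun=> pB) S /\
    forall a : R -> 'rV[R]_2, admissible free pA a ->
      let xA := motion pA a in
      let xB := fun j => motion pB (S (fun=> xA) j) in
      prevented target rC xA xB.

(* A graph on V is given by its set of edges, each a two-element subset of V. *)
Definition matching (V : finType) (E M : {set {set V}}) : Prop :=
  M \subset E /\ finset.trivIset M.

Definition maximum_matching (V : finType) (E M : {set {set V}}) : Prop :=
  matching E M /\ forall M' : {set {set V}}, matching E M' -> (#|M'| <= #|M|)%N.

Definition game_graph (R : realType) (free target : set 'rV[R]_2) (rC : R)
    (NA ND : nat) (A : 'I_NA -> player R) (B : 'I_ND -> player R) :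
    {set {set 'I_NA + 'I_ND}} :=
  [set e : {set 'I_NA + 'I_ND} | `[< exists (i : 'I_ND) (j : 'I_NA),
     e = [set inl j; inr i]%SET /\
     defender_wins free target rC (B i) (A j) >]]%SET.

(* Main.v *)
Require Import Defs.
From HB Require Import structures.
From mathcomp Require Import all_boot all_order all_algebra.
From mathcomp Require Import all_classical all_reals all_analysis.
Import Order.TTheory GRing.Theory Num.Theory.
Import numFieldNormedType.Exports.
Local Open Scope classical_set_scope.
Local Open Scope ring_scope.

(** The defending team splits a matching into separate duels: a matched
    defender plays its winning two-player strategy against its own partner,
    ignoring every other player, and an unmatched defender stands still.  As
    matching edges are disjoint, no defender is asked to fight two duels
    ([matching_partner_unique]), so these strategies can be played together
    and each is still a closed-loop strategy of the large game
    ([closed_loop_observe_one]).  An attacker stopped by its partner remains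
    stopped when more defenders are present ([prevented_more_defenders]), and
    distinct edges stop distinct attackers ([matching_card_le_endpoints]);
    hence at least as many attackers are stopped as there are edges.  The
    second bound is the complement of the first, since a prevented attacker
    cannot also reach the target uncaptured
    ([prevented_not_reaches_uncaptured]). *)

Section Outcomes.
Context {R : realType} (target : set 'rV[R]_2) (rC : R).

Lemma prevented_more_defenders {J K : Type} (f : J -> K)
    (xA : R -> 'rV[R]_2) (xB : J -> R -> 'rV[R]_2) (yB : K -> R -> 'rV[R]_2) :
  (forall j, xB j = yB (f j)) ->
  prevented target rC xA xB -> prevented target rC xA yB.
Proof.
move=> xByB [[s [s0 [j sj]] nt]|nt]; last by right.
by left; exists s => //; split=> //; exists (f j); rewrite -xByB.
Qed.

Lemma prevented_not_reaches_uncaptured {J : Type}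
    (xA : R -> 'rV[R]_2) (xB : J -> R -> 'rV[R]_2) :
  prevented target rC xA xB -> ~ reaches_uncaptured target rC xA xB.
Proof.
move=> [[s cs nt]|nt] [t [t0 tt uncaptured]]; last exact: nt t0 tt.
case: (leP s t) => [st|ts].
  by apply: (uncaptured s _ cs); rewrite st andbT; case: cs.
by apply: (nt t) => //; rewrite t0.
Qed.

End Outcomes.

Section Strategies.
Context {R : realType} (free : set 'rV[R]_2).

Lemma motion_zero_control (p : player R) (t : R) :
  motion p (fun=> 0) t = start p.
Proof.
apply/rowP => k; rewrite mxE.
under eq_Rintegral do rewrite mxE.
by rewrite Rintegral_cst ?measurable_itv// mul0r mulr0 addr0.
Qed.

Lemma admissible_zero_control (p : player R) :
  free (start p) -> admissible free p (fun=> 0).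
Proof.
move=> pfree; split=> [|t _]; last by rewrite motion_zero_control.
split=> [k|t _]; first exact: measurable_cst.
by rewrite /norm2 big1 ?sqrtr0// => k _; rewrite mxE expr0n.
Qed.

Lemma closed_loop_stand_still {I J : Type} (A : I -> player R)
    (B : J -> player R) :
  (forall j, free (start (B j))) ->
  closed_loop_strategy free A B (fun _ _ => fun=> 0).
Proof.
move=> Bfree; split=> [a _ j|a a' t _ _ _ j]; first exact: admissible_zero_control.
exact: aeW.
Qed.

(** If all attackers have admissible controls, or move identically up to time
    [t], then so does attacker [i] alone; hence admissibility and
    nonanticipation of the duel strategy carry over to the large game. *)
Lemma closed_loop_observe_one {I J : Type} (A : I -> player R)
    (B : J -> player R) (i : I) (S : (unit -> R -> 'rV[R]_2) -> J -> R -> 'rV[R]_2) :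
  closed_loop_strategy free (fun=> A i) B S ->
  closed_loop_strategy free A B (fun x => S (fun=> x i)).
Proof.
move=> [adm nonant]; split=> [a aadm j|a a' t aadm a'adm aa' j].
  exact: (adm (fun=> a i)).
by apply: (nonant (fun=> a i) (fun=> a' i)) => // _; exact: aa'.
Qed.

(** Admissibility and nonanticipation are conditions on each defender
    separately, so the defenders need not coordinate. *)
Lemma closed_loop_team {I J : Type} (A : I -> player R) (B : J -> player R)
    (S : J -> (I -> R -> 'rV[R]_2) -> unit -> R -> 'rV[R]_2) :
  (forall j, closed_loop_strategy free A (fun=> B j) (S j)) ->
  closed_loop_strategy free A B (fun x j => S j x tt).
Proof.
move=> SP; split=> [a aadm j|a a' t aadm a'adm aa' j].
  exact: (SP j).1 a aadm tt.
exact: (SP j).2 a a' t aadm a'adm aa' tt.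
Qed.

End Strategies.

Section Matchings.
Context {I J : finType}.

Lemma bipartite_edge_inj (i i' : I) (j j' : J) :
  [set inl i; inr j]%SET = [set inl i'; inr j']%SET -> i = i' /\ j = j'.
Proof.
move=> e; split.
  have : inl i \in [set inl i'; inr j']%SET by rewrite -e set21.
  by case/set2P => // -[].
have : inr j \in [set inl i'; inr j']%SET by rewrite -e set22.
by case/set2P => // -[].
Qed.

Lemma matching_partner_unique (E M : {set {set I + J}}) (i i' : I) (j : J) :
  matching E M -> [set inl i; inr j]%SET \in M ->
  [set inl i'; inr j]%SET \in M -> i = i'.
Proof.
move=> [_ disj] ijM i'jM.
suff /bipartite_edge_inj[] :
  [set inl i; inr j]%SET = [set inl i'; inr j]%SET :> {set I + J} by [].
by rewrite -(def_pblock disj ijM (set22 _ _)) (def_pblock disj i'jM (set22 _ _)).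
Qed.

(** By disjointness the edge is recovered from its left endpoint, as the block
    containing it. *)
Lemma matching_card_le_endpoints (E M : {set {set I + J}}) (P : {set I}) :
  matching E M ->
  (forall e, e \in M ->
     exists (i : I) (j : J), e = [set inl i; inr j]%SET /\ i \in P) ->
  (#|M| <= #|P|)%N.
Proof.
move=> [_ disj] MP.
apply: leq_trans (leq_imset_card (fun i => finset.pblock M (inl i)) (mem P)).
apply/subset_leq_card/fintype.subsetP => e eM.
have [i [j [eij iP]]] := MP e eM.
apply/imsetP; exists i => //.
by rewrite (def_pblock disj eM)// eij set21.
Qed.

End Matchings.

Section Duels.
Context {R : realType} (free target : set 'rV[R]_2) (rC : R) {NA ND : nat}.
Variables (A : 'I_NA -> player R) (B : 'I_ND -> player R).

Lemma game_graph_edge (j : 'I_NA) (i : 'I_ND) :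
  [set inl j; inr i]%SET \in game_graph free target rC A B ->
  defender_wins free target rC (B i) (A j).
Proof.
by rewrite inE => /asboolP[i' [j' [/bipartite_edge_inj[-> ->]]]].
Qed.

(** The quantifier over partners covers an unmatched defender (vacuously) and a
    matched one, whose partner is unique. *)
Lemma matching_strategy (M : {set {set 'I_NA + 'I_ND}}) (i : 'I_ND) :
  free (start (B i)) -> matching (game_graph free target rC A B) M ->
  exists S : ('I_NA -> R -> 'rV[R]_2) -> unit -> R -> 'rV[R]_2,
    closed_loop_strategy free A (fun=> B i) S /\
    forall j, [set inl j; inr i]%SET \in M ->
    forall a : 'I_NA -> R -> 'rV[R]_2,
      (forall j, admissible free (A j) (a j)) ->
      let xA := fun j => motion (A j) (a j) in
      prevented target rC (xA j) (fun k => motion (B i) (S xA k)).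
Proof.
move=> Bfree Mmatch.
have [[j jiM]|unmatched] :=
    pselect (exists j, [set inl j; inr i]%SET \in M); last first.
  exists (fun _ _ => fun=> 0); split; first exact: closed_loop_stand_still.
  by move=> j jiM; case: unmatched; exists j.
have [S [Sloop Swins]] : defender_wins free target rC (B i) (A j).
  by apply: game_graph_edge; apply: (fintype.subsetP Mmatch.1).
exists (fun x => S (fun=> x j)); split; first exact: closed_loop_observe_one.
move=> j' /(matching_partner_unique _ _ _ _ _ Mmatch jiM) <- a aadm.
exact: Swins.
Qed.

End Duels.

Theorem mainTheorem1 (R : realType)
  (Omega free target : set 'rV[R]_2) (rC : R)
  (NA ND : nat) (A : 'I_NA -> player R) (B : 'I_ND -> player R)
  (Omega_open : open Omega) (Omega_bounded : bounded_set Omega)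
  (free_sub : free `<=` Omega) (free_compact : compact free)
  (target_sub : target `<=` free) (target_compact : compact target)
  (rC_ge0 : 0 <= rC)
  (A_free : forall j, free (start (A j))) (B_free : forall i, free (start (B i)))
  (A_speed : forall j, 0 <= max_speed (A j))
  (B_speed : forall i, 0 <= max_speed (B i))
  (M : {set {set 'I_NA + 'I_ND}}) (m : nat)
  (M_max : maximum_matching (game_graph free target rC A B) M)
  (M_card : #|M| = m) :
  exists S : ('I_NA -> R -> 'rV[R]_2) -> 'I_ND -> R -> 'rV[R]_2,
    closed_loop_strategy free A B S /\
    forall a : 'I_NA -> R -> 'rV[R]_2,
      (forall j, admissible free (A j) (a j)) ->
      let xA := fun j => motion (A j) (a j) in
      let xB := fun i => motion (B i) (S xA i) in
      (m <= #|[set j : 'I_NA | `[< prevented target rC (xA j) xB >]]%SET|)%N /\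
      (#|[set j : 'I_NA | `[< reaches_uncaptured target rC (xA j) xB >]]%SET|
         <= NA - m)%N.
Proof.
have [Mmatch _] := M_max.
have [S SP] := choice (fun i =>
  matching_strategy free target rC A B M i (B_free i) Mmatch).
exists (fun x i => S i x tt); split.
  by apply: closed_loop_team => i; exact: (SP i).1.
move=> a aadm xA xB.
set P := [set j | `[< prevented _ _ _ _ >]]%SET.
have mP : (m <= #|P|)%N.
  rewrite -M_card; apply: (matching_card_le_endpoints _ _ _ Mmatch) => e eM.
  have := fintype.subsetP Mmatch.1 _ eM.
  rewrite inE => /asboolP[i [j [eji _]]].
  exists j, i; split=> //; rewrite inE; apply/asboolP.
  apply: (prevented_more_defenders _ _ (fun=> i)) ((SP i).2 j _ a aadm).
    by case.
  by rewrite -eji.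
split=> //; apply: leq_trans (leq_sub2l NA mP).
have -> : (NA - #|P| = #|~: P|)%N by rewrite [RHS]cardsCs finset.setCK card_ord.
apply/subset_leq_card/fintype.subsetP => j; rewrite !inE => reach.
by apply/asboolPn => /prevented_not_reaches_uncaptured /(_ reach).
Qed.
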